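(* Let $G$ be a group, $s\in G$ and $M$ a $G$-module. (i) Let $h_s:C(G,M)\to C(G,M)[-1]$ be given, for $n\ge0$, by $h_s:C^{n+1}(G,M)\to C^n(G,M)$, $$h_s(a)(s_0,\ldots,s_n)=\sum_{i=0}^n(-1)^ia(s_0,\ldots,s_i,s_is,\ldots,s_ns)$$ (and $h_s=0$ on $C^0(G,M)$). Then $h_s$ is a homotopy from the action of $s$ on $C(G,M)$ to the identity, i.e. $sa-a=(h_sd+dh_s)(a)$ for all $a\in C(G,M)$. (ii) In terms of inhomogeneous cochains, $h_s:C^{n+1}(G,M)\to C^n(G,M)$ is given by $$h_s(a)(s_1,\ldots,s_n)=\sum_{i=0}^n(-1)^ia(s_1,\ldots,s_i,s,s^{-1}s_{i+1}s,\ldots,s^{-1}s_ns).$$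
   Context: $F$ is the standard resolution of $\mathbb{Z}$ over $\mathbb{Z}G$: $F_n=\mathbb{Z}G^{n+1}$ for $n\ge0$, with $u(s_0,\ldots,s_n)=(us_0,\ldots,us_n)$ and $\partial(s_0,\ldots,s_n)=\sum_{i=0}^n(-1)^i(s_0,\ldots,\hat s_i,\ldots,s_n)$. The complex of homogeneous cochains is $C(G,M)=\mathrm{Hom}_G(F,M)$, $C^n(G,M)=\mathrm{Hom}_G(F_n,M)$ for $n\ge 0$ and $C^{-1}(G,M)=0$, with $(da)(x)=a(\partial x)$ (no sign). $C(G,M)[-1]^n=C^{n-1}(G,M)$. The action of $s\in G$ on homogeneous cochains is $(sa)(s_0,\ldots,s_n)=s\,a(s^{-1}s_0s,\ldots,s^{-1}s_ns)=a(s_0s,\ldots,s_ns)$. Inhomogeneous $n$-cochains are functions $a:G^n\to M$. The inhomogeneous cochain $a$ corresponds to the homogeneous cochain $\bar a$ given by $\bar a(t_0,\ldots,t_n)=t_0\,a(t_0^{-1}t_1,\ldots,t_{n-1}^{-1}t_n)$; conversely $a(s_1,\ldots,s_n)=\bar a(t_0,\ldots,t_n)$ with $t_i=s_1\cdots s_i$, $t_0=1$. Part (ii) describes the map on inhomogeneous cochains obtained by transporting the homogeneous $h_s$ of part (i) through this isomorphism. *)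

(* Defs.v *)
From HB Require Import structures.
From mathcomp Require Import all_boot all_algebra.
From mathcomp Require Import zify boolp freeg.

Set Implicit Arguments.
Unset Strict Implicit.
Unset Printing Implicit Defensive.

Import GRing.Theory.

Local Open Scope ring_scope.

Record gModule (G : groupType) := GModule {
  gm_sort :> zmodType;
  gact : G -> gm_sort -> gm_sort;
  gactD : forall u x y, gact u (x + y) = gact u x + gact u y;
  gact1 : forall x, gact 1%g x = x;
  gactM : forall u v x, gact (u * v)%g x = gact u (gact v x)
}.
Arguments gact {G g} u x.

Section GModuleTheory.
Variables (G : groupType) (M : gModule G).

Lemma gact_is_zmod_morphism (u : G) : zmod_morphism (@gact G M u).
Proof.
have g0 : gact u (0 : M) = 0.
  by apply: (addrI (gact u 0)); rewrite -gactD !addr0.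
move=> x y; rewrite gactD; congr (_ + _).
by apply: (addrI (gact u y)); rewrite -gactD !subrr.
Qed.

HB.instance Definition _ (u : G) :=
  GRing.isZmodMorphism.Build M M (@gact G M u) (gact_is_zmod_morphism u).

Lemma gact_sum u (I : Type) (r : seq I) (P : pred I) (F : I -> M) :
  gact u (\sum_(i <- r | P i) F i) = \sum_(i <- r | P i) gact u (F i).
Proof. exact: raddf_sum. Qed.

Lemma gact_mulz u (x : M) (m : int) : gact u (x *~ m) = gact u x *~ m.
Proof. exact: raddfMz. Qed.

End GModuleTheory.

Record homG (G : groupType) (X Y : gModule G) := HomG {
  hom_fun :> X -> Y;
  hom_zmod : zmod_morphism hom_fun;
  hom_act : forall u x, hom_fun (gact u x) = gact u (hom_fun x)
}.

Section HomG.
Variables (G : groupType) (X Y : gModule G).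
Implicit Types f g h : homG X Y.

HB.instance Definition _ f :=
  GRing.isZmodMorphism.Build X Y f (hom_zmod f).

HB.instance Definition _ := gen_eqMixin (homG X Y).
HB.instance Definition _ := gen_choiceMixin (homG X Y).

Lemma homG_ext f g : f =1 g -> f = g.
Proof.
case: f g => [f f1 f2] [g g1 g2] /= /funext fg.
by case: _ / fg in g1 g2 *; congr HomG; exact: Prop_irrelevance.
Qed.

Fact homG0_zmod : zmod_morphism (fun _ : X => 0 : Y).
Proof. by move=> x y; rewrite subr0. Qed.
Fact homG0_act u (x : X) : (0 : Y) = gact u 0.
Proof. by rewrite raddf0. Qed.
Definition homG0 := HomG homG0_zmod homG0_act.

Fact homGN_zmod f : zmod_morphism (fun x : X => - f x).
Proof. by move=> x y; rewrite raddfB opprB opprK addrC. Qed.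
Fact homGN_act f u (x : X) : - f (gact u x) = gact u (- f x).
Proof. by rewrite hom_act raddfN. Qed.
Definition homGN f := HomG (homGN_zmod f) (homGN_act f).

Fact homGD_zmod f g : zmod_morphism (fun x : X => f x + g x).
Proof. by move=> x y; rewrite !raddfB opprD addrACA. Qed.
Fact homGD_act f g u (x : X) :
  f (gact u x) + g (gact u x) = gact u (f x + g x).
Proof. by rewrite !hom_act raddfD. Qed.
Definition homGD f g := HomG (homGD_zmod f g) (homGD_act f g).

Fact homGDA : associative homGD.
Proof. by move=> f g h; apply: homG_ext => x /=; rewrite addrA. Qed.
Fact homGDC : commutative homGD.
Proof. by move=> f g; apply: homG_ext => x /=; rewrite addrC. Qed.
Fact homG0D : left_id homG0 homGD.
Proof. by move=> f; apply: homG_ext => x /=; rewrite add0r. Qed.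
Fact homGND : left_inverse homG0 homGN homGD.
Proof. by move=> f; apply: homG_ext => x /=; rewrite addNr. Qed.

HB.instance Definition _ :=
  GRing.isZmodule.Build (homG X Y) homGDA homGDC homG0D homGND.

Lemma hom0E (x : X) : (0 : homG X Y) x = 0. Proof. by []. Qed.
Lemma homDE f g (x : X) : (f + g) x = f x + g x. Proof. by []. Qed.
Lemma homNE f (x : X) : (- f) x = - f x. Proof. by []. Qed.
Lemma homBE f g (x : X) : (f - g) x = f x - g x. Proof. by []. Qed.

Lemma hom_sum f (I : Type) (r : seq I) (P : pred I) (F : I -> X) :
  f (\sum_(i <- r | P i) F i) = \sum_(i <- r | P i) f (F i).
Proof. exact: raddf_sum. Qed.

Lemma hom_mulz f (x : X) (m : int) : f (x *~ m) = f x *~ m.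
Proof. exact: raddfMz. Qed.

End HomG.

(* The integer n - 1, by a formula that computes on constructors: X^(n-1) is
   then literally X (zpred n), with no transport along n.+1 - 1 = n. *)
Definition zpred (n : int) : int :=
  match n with
  | Posz 0 => Negz 0
  | Posz k.+1 => Posz k
  | Negz k => Negz k.+1
  end.

Lemma zpredE n : zpred n = n - 1.
Proof. by case: n => [[|n]|n] //=; rewrite ?NegzE; lia. Qed.

(* cxd n is the differential from degree n - 1 to degree n. *)
Record cochain_complex := CochainComplex {
  cx :> int -> zmodType;
  cxd : forall n, {additive cx (zpred n) -> cx n};
  cxdd : forall n x, cxd n (cxd (zpred n) x) = 0
}.
Arguments cxd {c} n.

Record cochain_map (X Y : cochain_complex) := CochainMap {
  cmap :> forall n, {additive X n -> Y n};
  cmapd : forall n x, cmap n (cxd n x) = cxd n (cmap (zpred n) x)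
}.

Definition id_cochain_map (X : cochain_complex) : cochain_map X X :=
  @CochainMap X X (fun n => idfun : {additive X n -> X n}) (fun _ _ => erefl).

(* Y[-1], as a graded group: Y[-1]^n = Y^(n-1) *)
Definition shiftN1 (Y : int -> zmodType) (n : int) : zmodType := Y (zpred n).

(* h is a homotopy from f to g: f - g = h d + d h. Since zpred is onto,
   x : X (zpred n) ranges over all degrees. *)
Definition is_homotopy (X Y : cochain_complex) (f g : cochain_map X Y)
    (h : forall n, {additive X n -> shiftN1 Y n}) :=
  forall (n : int) (x : X (zpred n)),
    f (zpred n) x - g (zpred n) x =
      h n (cxd n x) + cxd (zpred n) (h (zpred n) x).

Section Linear.
Variable K : choiceType.

(* The library's lift is linear; V^z is V as a module over the integers. *)
Definition freeg_lin (V : zmodType) (f : K -> V) (x : {freeg K / int}) : V :=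
  fglift (f : K -> zmodule V) x.

Lemma freeg_lin_is_zmod_morphism (V : zmodType) (f : K -> V) :
  zmod_morphism (freeg_lin f).
Proof. exact: (@lift_is_additive int K (zmodule V) f). Qed.

HB.instance Definition _ (V : zmodType) (f : K -> V) :=
  GRing.isZmodMorphism.Build {freeg K / int} V (freeg_lin f)
    (freeg_lin_is_zmod_morphism f).

Lemma freeg_linU (V : zmodType) (f : K -> V) (k : K) :
  freeg_lin f << k >> = f k.
Proof. by rewrite /freeg_lin liftU scale1r. Qed.

Lemma freeg_additive_ext (V : zmodType) (f g : {freeg K / int} -> V) :
  zmod_morphism f -> zmod_morphism g ->
  (forall k, f << k >> = g << k >>) -> f =1 g.
Proof.
move=> fA gA fg x.
pose fM := GRing.isZmodMorphism.Build {freeg K / int} V f fA.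
pose gM := GRing.isZmodMorphism.Build {freeg K / int} V g gA.
pose f' : {additive {freeg K / int} -> V} := HB.pack f fM.
pose g' : {additive {freeg K / int} -> V} := HB.pack g gM.
rewrite -[f x]/(f' x) -[g x]/(g' x) -(freeg_sumE x) !raddf_sum.
apply: eq_bigr => k _; rewrite -[X in << X *g _ >>]intz -freegU_mulz !raddfMz.
by congr (_ *~ _); apply: fg.
Qed.

End Linear.

Section StandardResolution.
Variable G : groupType.

Definition ltrans n (u : G) (t : n.-tuple G) : n.-tuple G :=
  [tuple of [seq (u * x)%g | x <- t]].

Definition stdres_act n (u : G) :
    {freeg (n.+1.-tuple G) / int} -> {freeg (n.+1.-tuple G) / int} :=
  freeg_lin (fun t => << ltrans u t >>).

Fact stdres_actD n u (x y : {freeg (n.+1.-tuple G) / int}) :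
  stdres_act u (x + y) = stdres_act u x + stdres_act u y.
Proof. exact: raddfD. Qed.

Fact stdres_act1 n (x : {freeg (n.+1.-tuple G) / int}) : stdres_act 1%g x = x.
Proof.
move: x; apply: freeg_additive_ext => [|x y|t] //; first exact: raddfB.
rewrite /stdres_act freeg_linU; congr << _ >>.
apply: val_inj => /=; rewrite -[RHS]map_id.
by apply: eq_map => x; rewrite mul1g.
Qed.

Fact stdres_actM n u v (x : {freeg (n.+1.-tuple G) / int}) :
  stdres_act (u * v)%g x = stdres_act u (stdres_act v x).
Proof.
move: x; apply: freeg_additive_ext => [|x y|t]; first exact: raddfB.
  by rewrite /stdres_act !raddfB.
rewrite /stdres_act !freeg_linU; congr << _ >>.
by apply: val_inj; rewrite /= -map_comp; apply: eq_map => x /=; rewrite mulgA.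
Qed.

Definition stdres (n : nat) : gModule G :=
  GModule (@stdres_actD n) (@stdres_act1 n) (@stdres_actM n).

Definition simplex n (t : n.+1.-tuple G) : stdres n := << t >>.

Lemma gact_simplex n u (t : n.+1.-tuple G) :
  gact u (simplex t) = simplex (ltrans u t).
Proof. exact: freeg_linU. Qed.

Definition face n (i : 'I_n.+1) (t : n.+1.-tuple G) : n.-tuple G :=
  [tuple tnth t (fintype.lift i j) | j < n].

Definition bdry_simplex n (t : n.+2.-tuple G) : stdres n :=
  \sum_(i < n.+2) simplex (face i t) *~ (-1) ^+ i.

Definition bdry n : stdres n.+1 -> stdres n :=
  freeg_lin (@bdry_simplex n).

Lemma bdry_is_zmod_morphism n : zmod_morphism (@bdry n).
Proof. exact: freeg_lin_is_zmod_morphism. Qed.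

HB.instance Definition _ n :=
  GRing.isZmodMorphism.Build (stdres n.+1) (stdres n) (@bdry n)
    (@bdry_is_zmod_morphism n).

Lemma bdry_sum n (I : Type) (r : seq I) (P : pred I) (F : I -> stdres n.+1) :
  bdry (\sum_(i <- r | P i) F i) = \sum_(i <- r | P i) bdry (F i).
Proof. exact: raddf_sum. Qed.

Lemma bdry_mulz n (x : stdres n.+1) (m : int) : bdry (x *~ m) = bdry x *~ m.
Proof. exact: raddfMz. Qed.

Lemma bdryE n (t : n.+2.-tuple G) :
  bdry (simplex t) = \sum_(i < n.+2) simplex (face i t) *~ (-1) ^+ i.
Proof. exact: freeg_linU. Qed.

Lemma stdres_ext n (V : zmodType) (f g : stdres n -> V) :
  zmod_morphism f -> zmod_morphism g ->
  (forall t, f (simplex t) = g (simplex t)) -> f =1 g.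
Proof. exact: freeg_additive_ext. Qed.

Lemma face_ltrans n u (i : 'I_n.+1) (t : n.+1.-tuple G) :
  face i (ltrans u t) = ltrans u (face i t).
Proof. by apply: eq_from_tnth => j; rewrite !(tnth_mktuple, tnth_map). Qed.

Lemma bdry_act n u (x : stdres n.+1) : bdry (gact u x) = gact u (bdry x).
Proof.
move: x; apply: stdres_ext => [x y|x y|t]; rewrite ?raddfB //.
rewrite gact_simplex !bdryE gact_sum; apply: eq_bigr => i _.
by rewrite gact_mulz gact_simplex face_ltrans.
Qed.

Lemma faceK n (i : 'I_n.+2) (j : 'I_n.+1) (i' : 'I_n.+2) (j' : 'I_n.+1)
    (t : n.+2.-tuple G) :
  (j < i)%N -> i' = j :> nat -> j' = i.-1 :> nat ->
  face j (face i t) = face j' (face i' t).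
Proof.
move=> ji ei ej; apply: eq_from_tnth => k; rewrite !tnth_mktuple.
congr tnth; apply: val_inj; rewrite /= /bump ei ej.
by case: (leqP j k) => ?; lia.
Qed.

Lemma simplicial_sum0 (V : zmodType) n (F : nat -> nat -> V) :
  (forall i j, (j < i <= n)%N -> F i j = - F j i.-1) ->
  \sum_(i < n.+1) \sum_(j < n) F i j = 0.
Proof.
elim: n => [|n IHn] FN; first by rewrite big1 // => i _; rewrite big_ord0.
rewrite big_ord_recr /=.
under eq_bigr do rewrite big_ord_recr /=.
rewrite big_split /= IHn ?add0r; last first.
  by move=> i j /andP[ji le_in]; apply: FN; rewrite ji leqW.
rewrite -big_split big1 // => i _.
by rewrite [F n.+1 i]FN ?ltn_ord //= subrr.
Qed.

Lemma bdry_bdry n (x : stdres n.+2) : bdry (bdry x) = 0.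
Proof.
move: x; apply: stdres_ext => [x y|x y|t]; rewrite ?raddfB ?subr0 //.
pose F i j : stdres n :=
  simplex (face (inord j) (face (inord i) t)) *~ (-1) ^+ (i + j).
rewrite bdryE bdry_sum.
transitivity (\sum_(i < n.+3) \sum_(j < n.+2) F i j).
  apply: eq_bigr => i _; rewrite bdry_mulz bdryE mulrz_suml.
  apply: eq_bigr => j _; rewrite /F !inord_val -mulrzA -exprD.
  by rewrite [(j + i)%N]addnC.
apply: simplicial_sum0 => i j /andP[ji le_in]; rewrite /F.
have -> : (i + j)%N = (j + i.-1).+1 by lia.
rewrite exprS mulN1r mulrNz; congr (- (simplex _ *~ _)).
by apply: faceK; rewrite !inordK; lia.
Qed.

End StandardResolution.

Section Cochains.
Variables (G : groupType) (M : gModule G).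

(* The cochain with prescribed values on the basis G^(n+1) of stdres n. *)
Section CochainOf.
Variables (n : nat) (f : n.+1.-tuple G -> M).
Hypothesis f_act : forall u t, f (ltrans u t) = gact u (f t).

Fact cochain_of_act u (x : stdres G n) :
  (freeg_lin f : stdres G n -> M) (gact u x) = gact u (freeg_lin f x).
Proof.
move: x; apply: (@stdres_ext G n) => [x y|x y|t].
- by rewrite !raddfB.
- by rewrite !raddfB.
- by rewrite gact_simplex /simplex !freeg_linU f_act.
Qed.

Definition cochain_of : homG (stdres G n) M :=
  @HomG G (stdres G n) M (freeg_lin f) (freeg_lin_is_zmod_morphism f)
    cochain_of_act.

Lemma cochain_ofE t : cochain_of (simplex t) = f t.
Proof. exact: freeg_linU. Qed.

End CochainOf.

Lemma cochain_ext n (a b : homG (stdres G n) M) :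
  (forall t, a (simplex t) = b (simplex t)) -> a = b.
Proof. by move=> ab; apply/homG_ext/stdres_ext => //; apply: hom_zmod. Qed.

(* C^n(G, M) = Hom_G(F_n, M) for n >= 0, and C^n(G, M) = 0 for n < 0
   ('I_1 is the zero group). *)
Definition cochain (n : int) : zmodType :=
  match n with
  | Posz k => homG (stdres G k) M
  | Negz _ => 'I_1
  end.

Section Coboundary.
Variable n : nat.
Implicit Type a : homG (stdres G n) M.

Fact cobdry_zmod a : zmod_morphism (fun x : stdres G n.+1 => a (bdry x)).
Proof. by move=> x y; rewrite !raddfB. Qed.

Fact cobdry_act a u (x : stdres G n.+1) :
  a (bdry (gact u x)) = gact u (a (bdry x)).
Proof. by rewrite bdry_act hom_act. Qed.

Definition cobdry a : homG (stdres G n.+1) M :=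
  HomG (cobdry_zmod a) (cobdry_act a).

Fact cobdry_is_zmod_morphism : zmod_morphism cobdry.
Proof. by move=> a b; apply: homG_ext. Qed.

HB.instance Definition _ :=
  GRing.isZmodMorphism.Build _ _ cobdry cobdry_is_zmod_morphism.

End Coboundary.

Definition cochain_d (n : int) : {additive cochain (zpred n) -> cochain n} :=
  match n return {additive cochain (zpred n) -> cochain n} with
  | Posz 0 => \0
  | Posz k.+1 => @cobdry k
  | Negz k => \0
  end.

Fact cochain_dd n (x : cochain (zpred (zpred n))) :
  cochain_d n (cochain_d (zpred n) x) = 0.
Proof.
case: n x => [[|[|n]]|n] //= x; first exact: (raddf0 (cobdry (n := 0))).
by apply: homG_ext => y /=; rewrite bdry_bdry raddf0.
Qed.

Definition cochains : cochain_complex := CochainComplex cochain_dd.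

Variable s : G.

(* (s a)(s_0, ..., s_n) = s a(s^-1 s_0 s, ..., s^-1 s_n s); x ^ s is s^-1 x s *)
Section ConjAction.
Variable n : nat.
Implicit Type a : homG (stdres G n) M.

Definition conj_act_fun a (t : n.+1.-tuple G) : M :=
  gact s (a (simplex [tuple of [seq (x ^ s)%g | x <- t]])).

Fact conj_act_fun_act a u t :
  conj_act_fun a (ltrans u t) = gact u (conj_act_fun a t).
Proof.
rewrite /conj_act_fun -gactM.
have -> : [tuple of [seq (x ^ s)%g | x <- ltrans u t]] =
    ltrans (u ^ s)%g [tuple of [seq (x ^ s)%g | x <- t]].
  by apply: eq_from_tnth => i; rewrite !tnth_map conjMg.
by rewrite -gact_simplex hom_act -gactM -conjgC.
Qed.

Definition conj_act a : homG (stdres G n) M := cochain_of (conj_act_fun_act a).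

Lemma conj_actE a t :
  conj_act a (simplex t) =
    gact s (a (simplex [tuple of [seq (x ^ s)%g | x <- t]])).
Proof. exact: cochain_ofE. Qed.

Lemma conj_act_mulr a t :
  conj_act a (simplex t) = a (simplex [tuple of [seq (x * s)%g | x <- t]]).
Proof.
rewrite conj_actE -hom_act gact_simplex; congr (a (simplex _)).
by apply: eq_from_tnth => i; rewrite !tnth_map -conjgC.
Qed.

Fact conj_act_is_zmod_morphism : zmod_morphism conj_act.
Proof.
move=> a b; apply: cochain_ext => t.
by rewrite homBE !conj_actE homBE raddfB.
Qed.

HB.instance Definition _ :=
  GRing.isZmodMorphism.Build _ _ conj_act conj_act_is_zmod_morphism.

End ConjAction.

Definition cochain_act (n : int) : {additive cochain n -> cochain n} :=
  match n return {additive cochain n -> cochain n} with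
  | Posz k => @conj_act k
  | Negz k => idfun
  end.

Fact cochain_actd (n : int) (x : cochain (zpred n)) :
  cochain_act n (cochain_d n x) = cochain_d n (cochain_act (zpred n) x).
Proof.
case: n x => [[|n]|n] // a; first exact: (raddf0 (conj_act (n := 0))).
apply: cochain_ext => t; rewrite conj_actE.
rewrite -[RHS]/(conj_act a (bdry (simplex t))) /cobdry [X in gact s X]/=.
rewrite !bdryE !hom_sum gact_sum; apply: eq_bigr => i _.
rewrite !hom_mulz gact_mulz conj_actE; congr (gact s (a (simplex _)) *~ _).
by apply: eq_from_tnth => j; rewrite !(tnth_map, tnth_mktuple).
Qed.

Definition conj_cochain_map : cochain_map cochains cochains :=
  @CochainMap cochains cochains cochain_act cochain_actd.

(* (s_0, ..., s_i, s_i s, ..., s_n s) *)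
Fact prism_size n (i : 'I_n.+1) (t : n.+1.-tuple G) :
  size (take i.+1 t ++ [seq (x * s)%g | x <- drop i t]) == n.+2.
Proof.
rewrite size_cat size_map size_take size_drop size_tuple.
by case: ltnP; have := ltn_ord i; lia.
Qed.
Definition prism n (i : 'I_n.+1) (t : n.+1.-tuple G) : n.+2.-tuple G :=
  Tuple (prism_size i t).

Section Homotopy.
Variable n : nat.
Implicit Type a : homG (stdres G n.+1) M.

Definition hs_fun a (t : n.+1.-tuple G) : M :=
  \sum_(i < n.+1) a (simplex (prism i t)) *~ (-1) ^+ i.

Fact hs_fun_act a u t : hs_fun a (ltrans u t) = gact u (hs_fun a t).
Proof.
rewrite /hs_fun gact_sum; apply: eq_bigr => i _.
rewrite gact_mulz -hom_act gact_simplex; congr (a (simplex _) *~ _).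
apply: val_inj; rewrite /= map_cat map_take -!map_drop -!map_comp.
congr (_ ++ _); rewrite !map_drop; congr drop.
by apply: eq_map => x /=; rewrite mulgA.
Qed.

Definition hs_pos a : homG (stdres G n) M := cochain_of (hs_fun_act a).

Lemma hs_posE a t :
  hs_pos a (simplex t) = \sum_(i < n.+1) a (simplex (prism i t)) *~ (-1) ^+ i.
Proof. exact: cochain_ofE. Qed.

Fact hs_pos_is_zmod_morphism : zmod_morphism hs_pos.
Proof.
move=> a b; apply: cochain_ext => t.
rewrite homBE !hs_posE -sumrB; apply: eq_bigr => i _.
by rewrite homBE mulrzBl.
Qed.

HB.instance Definition _ :=
  GRing.isZmodMorphism.Build _ _ hs_pos hs_pos_is_zmod_morphism.

End Homotopy.

Definition hs (n : int) : {additive cochain n -> shiftN1 cochain n} :=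
  match n return {additive cochain n -> shiftN1 cochain n} with
  | Posz 0 => \0
  | Posz k.+1 => @hs_pos k
  | Negz k => \0
  end.

Definition icochain (n : nat) := n.-tuple G -> M.

(* (t_0^-1 t_1, ..., t_(n-1)^-1 t_n) *)
Definition quotients n (t : n.+1.-tuple G) : n.-tuple G :=
  [tuple of pairmap (fun x y => x^-1 * y)%g (thead t) (behead t)].

(* (1, s_1, s_1 s_2, ..., s_1 ... s_n) *)
Definition products n (t : n.-tuple G) : n.+1.-tuple G :=
  [tuple of 1%g :: scanl (fun x y => x * y)%g 1%g t].

Definition hom_fun_of n (a : icochain n) (t : n.+1.-tuple G) : M :=
  gact (thead t) (a (quotients t)).

Fact hom_fun_of_act n (a : icochain n) u t :
  hom_fun_of a (ltrans u t) = gact u (hom_fun_of a t).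
Proof.
rewrite /hom_fun_of -gactM; case/tupleP: t => x t.
have -> : quotients (ltrans u [tuple of x :: t]) = quotients [tuple of x :: t].
  apply: val_inj => /=; rewrite !theadE /=.
  rewrite /thead tnth_map tnth0.
  elim: (val t) x => //= y r IH x; rewrite IH; congr (_ :: _).
  by rewrite invgM -mulgA mulKg.
by rewrite /thead tnth_map.
Qed.

Definition homogenize n (a : icochain n) : homG (stdres G n) M :=
  cochain_of (hom_fun_of_act a).

Lemma homogenizeE n (a : icochain n) t :
  homogenize a (simplex t) = gact (thead t) (a (quotients t)).
Proof. exact: cochain_ofE. Qed.

Definition dehomogenize n (a : homG (stdres G n) M) : icochain n :=
  fun t => a (simplex (products t)).

Lemma quotientsK n (t : n.-tuple G) : quotients (products t) = t.
Proof.
apply: val_inj; rewrite /= /thead (tnth_nth 1%g) /=.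
by elim: (val t) (1%g) => //= y r IH x; rewrite mulKg IH.
Qed.

Lemma productsK n (t : n.+1.-tuple G) :
  ltrans (thead t) (products (quotients t)) = t.
Proof.
case/tupleP: t => x t; apply: val_inj; rewrite /= theadE mulg1; congr (_ :: _).
suff -> : forall r y z, [seq (x * w)%g | w <- scanl (fun v w => v * w)%g y
    (pairmap (fun v w => v^-1 * w)%g z r)] =
  [seq (x * y * z^-1 * w)%g | w <- r].
  by rewrite -[RHS]map_id; apply: eq_map => w; rewrite mulg1 mulgV mul1g.
elim=> //= w r IH y z; rewrite IH !mulgA; congr (_ :: _).
by apply: eq_map => v; rewrite mulgK.
Qed.

Lemma homogenizeK n : cancel (@homogenize n) (@dehomogenize n).
Proof.
move=> a; apply: funext => t; rewrite /dehomogenize homogenizeE quotientsK.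
by rewrite theadE gact1.
Qed.

Lemma dehomogenizeK n : cancel (@dehomogenize n) (@homogenize n).
Proof.
move=> a; apply: cochain_ext => t; rewrite homogenizeE /dehomogenize.
by rewrite -hom_act gact_simplex productsK.
Qed.

(* (s_1, ..., s_i, s, s^-1 s_(i+1) s, ..., s^-1 s_n s) *)
Fact iprism_size n (i : 'I_n.+1) (t : n.-tuple G) :
  size (take i t ++ s :: [seq (x ^ s)%g | x <- drop i t]) == n.+1.
Proof.
rewrite size_cat /= size_map size_take size_drop size_tuple.
by case: ltnP; have := ltn_ord i; lia.
Qed.
Definition iprism n (i : 'I_n.+1) (t : n.-tuple G) : n.+1.-tuple G :=
  Tuple (iprism_size i t).

End Cochains.

(* Main.v *)
Require Import Defs.
From mathcomp Require Import all_boot all_algebra.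
From mathcomp Require Import zify.

(** The prism operator: on the simplices of the prism over (s_0, ..., s_n) the
    inner faces telescope to (s_0 s, ..., s_n s) - (s_0, ..., s_n), while the
    remaining faces are the prisms over the faces of (s_0, ..., s_n), with the
    opposite sign. *)

Import GRing.Theory.

Local Open Scope ring_scope.

(* [F i j] stands for the j-th face of the i-th prism simplex, [H j i] for the
   i-th prism simplex over the j-th face, both with signs. *)
Lemma prism_sum {V : zmodType} {m : nat} {F H : nat -> nat -> V} (q : nat -> V) :
  (forall i, (i <= m)%N -> F i i = q i) ->
  (forall i, (i <= m)%N -> F i i.+1 = - q i.+1) ->
  (forall i j, (j < i <= m)%N -> F i j = - H j i.-1) ->
  (forall i j, (i < j <= m)%N -> F i j.+1 = - H j i) ->
  \sum_(i < m.+1) \sum_(j < m.+2) F i j + \sum_(j < m.+1) \sum_(i < m) H j i =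
    q 0%N - q m.+1.
Proof.
move=> Fd Fd1 Flt Fgt.
(* Off the diagonal, [unbump j i] is [i.-1] for [j < i] and [i] for [i < j]: the prism index that
   remains once entry [j] of the base is deleted. *)
pose A i j := if i == j then 0 else H j (unbump j i).
have rowE (i : 'I_m.+1) :
    \sum_(j < m.+2) F i j = (q i - q i.+1) - \sum_(j < m.+1) A i j.
  have lti := ltn_ord i.
  (* Removing column [i] renumbers the others by [bump i], so column [i.+1] now has index [i] and is
     split off next. *)
  rewrite (bigD1_ord (widen_ord (leqnSn _) i)) //= Fd // (bigD1 i) //=.
  rewrite /bump leqnn Fd1 // addrA; congr (_ + _).
  rewrite [in RHS](bigD1 i) //= /A eqxx add0r -sumrN; apply: eq_bigr => j neji.
  have ltj := ltn_ord j; have {}neji : (j != i :> nat) by [].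
  rewrite eq_sym (negbTE neji) /unbump.
  case: (ltngtP i j) neji => //= ij _; rewrite ?add1n ?add0n ?subn0 ?subn1.
    by rewrite Fgt ?ij.
  by rewrite Flt ?ij.
rewrite (eq_bigr _ (fun i _ => rowE i)) sumrB exchange_big /=.
have -> : \sum_(j < m.+1) \sum_(i < m.+1) A i j =
    \sum_(j < m.+1) \sum_(i < m) H j i.
  (* For fixed [j], the rows other than [j] are the values of [bump j], which [unbump j] inverts. *)
  apply: eq_bigr => j _; rewrite (bigD1_ord j) //= {1}/A eqxx add0r.
  apply: eq_bigr => i _; rewrite /A bumpK.
  by rewrite eq_sym (negbTE (neq_bump _ _)).
rewrite subrK; under eq_bigr do rewrite -opprB.
by rewrite sumrN -(big_mkord xpredT (fun i => q i.+1 - q i)) telescope_sumr ?opprB.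
Qed.

(** * Faces of the prism simplices *)

Section Prism.
Variables (G : groupType) (s : G).
Local Notation nth := (seq.nth 1%g).

Lemma eq_from_nth_tuple n (t u : n.-tuple G) :
  (forall k, (k < n)%N -> nth t k = nth u k) -> t = u.
Proof.
by move=> tu; apply/val_inj/(@eq_from_nth _ 1%g) => [|k]; rewrite !size_tuple // => /tu.
Qed.

Lemma nth_face n (i : 'I_n.+1) (t : n.+1.-tuple G) k :
  (k < n)%N -> nth (face i t) k = nth t (bump i k).
Proof.
move=> ltk; rewrite -[k in LHS]/(val (Ordinal ltk)) -tnth_nth tnth_mktuple.
by rewrite (tnth_nth 1%g).
Qed.

Lemma nth_prism n (i : 'I_n.+1) (t : n.+1.-tuple G) k :
  (k < n.+2)%N ->
  nth (prism s i t) k = if (k <= i)%N then nth t k else (nth t k.-1 * s)%g.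
Proof.
move=> ltk; have lti := ltn_ord i.
have szt : size (take i.+1 t) = i.+1 by rewrite size_takel ?size_tuple.
rewrite /= nth_cat szt ltnS; case: leqP => [le_ki | lt_ik].
  by rewrite nth_take.
rewrite (nth_map 1%g) ?size_drop ?size_tuple; last by lia.
by rewrite nth_drop; congr (nth _ _ * _)%g; lia.
Qed.

(* (s_0, ..., s_(i-1), s_i s, ..., s_n s), the i-th slice of the prism. *)
Definition slice {n} (i : nat) (t : n.-tuple G) : n.-tuple G :=
  [tuple if (k < i)%N then tnth t k else (tnth t k * s)%g | k < n].

Lemma nth_slice n i (t : n.-tuple G) k :
  (k < n)%N -> nth (slice i t) k = if (k < i)%N then nth t k else (nth t k * s)%g.
Proof.
move=> ltk; rewrite -[k in LHS]/(val (Ordinal ltk)) -tnth_nth tnth_mktuple.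
by rewrite (tnth_nth 1%g).
Qed.

Lemma slice0 n (t : n.-tuple G) :
  slice 0 t = [tuple of [seq (x * s)%g | x <- t]].
Proof. by apply: eq_from_tnth => k; rewrite tnth_mktuple tnth_map. Qed.

Lemma slice_size n (t : n.-tuple G) : slice n t = t.
Proof. by apply: eq_from_tnth => k; rewrite tnth_mktuple ltn_ord. Qed.

Lemma face_prism_diag {n} {i : 'I_n.+1} (j : 'I_n.+2) (t : n.+1.-tuple G) :
  j = i :> nat -> face j (prism s i t) = slice i t.
Proof.
move=> ji; apply: eq_from_nth_tuple => k ltk.
rewrite nth_face ?nth_prism ?nth_slice ?ji /bump //; last by lia.
by case: leqP => ik; rewrite ?add1n ?add0n ?ltnNge ?ik ?(ltnW ik).
Qed.

(** With [face_prism_diag], this shows that consecutive prism simplices [i] and [i.+1] share the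
    face [slice i.+1 t], which is why the inner faces telescope. *)
Lemma face_prism_diagS {n} {i : 'I_n.+1} (j : 'I_n.+2) (t : n.+1.-tuple G) :
  j = i.+1 :> nat -> face j (prism s i t) = slice i.+1 t.
Proof.
move=> ji; apply: eq_from_nth_tuple => k ltk.
rewrite nth_face ?nth_prism ?nth_slice ?ji /bump ?ltnS //; last by lia.
by case: ltnP => ik; rewrite ?add1n ?add0n ?ltnNge ?ik // ltnW.
Qed.

(** The deleted entry lies in the block not multiplied by [s]; that block gets shorter, so the prism
    index drops by one. *)
Lemma face_prism_lt n (i : 'I_n.+2) (j : 'I_n.+3) (i' : 'I_n.+1) (j' : 'I_n.+2)
    (t : n.+2.-tuple G) :
  (j < i)%N -> j' = j :> nat -> i' = i.-1 :> nat ->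
  face j (prism s i t) = prism s i' (face j' t).
Proof.
move=> ji ej ei; apply: eq_from_nth_tuple => k ltk; have lti := ltn_ord i.
rewrite nth_face ?nth_prism ?ej ?ei; try by rewrite /bump; lia.
case: (leqP k i.-1) => ki.
  rewrite nth_face ?ej; last by lia.
  by have -> : (bump j k <= i)%N by rewrite /bump; lia.
rewrite nth_face ?ej; last by lia.
have -> : (bump j k <= i)%N = false by rewrite /bump; lia.
by congr (nth _ _ * _)%g; rewrite /bump; lia.
Qed.

(** Position [j] of the prism holds entry [j.-1] of [t] times [s]; deleting it leaves the first
    block, hence the prism index, unchanged. *)
Lemma face_prism_gt n (i : 'I_n.+2) (j : 'I_n.+3) (i' : 'I_n.+1) (j' : 'I_n.+2)
    (t : n.+2.-tuple G) :
  (i.+1 < j)%N -> j' = j.-1 :> nat -> i' = i :> nat ->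
  face j (prism s i t) = prism s i' (face j' t).
Proof.
move=> ij ej ei; apply: eq_from_nth_tuple => k ltk; have ltj := ltn_ord j.
rewrite nth_face ?nth_prism ?ej ?ei; try by rewrite /bump; lia.
case: (leqP k i) => ki.
  rewrite nth_face ?ej; last by lia.
  have -> : (bump j k <= i)%N by rewrite /bump; lia.
  by congr (nth _ _); rewrite /bump; lia.
rewrite nth_face ?ej; last by lia.
have -> : (bump j k <= i)%N = false by rewrite /bump; lia.
by congr (nth _ _ * _)%g; rewrite /bump; lia.
Qed.

(** * Passage to inhomogeneous coordinates *)

Lemma nth_quotients n (t : n.+1.-tuple G) k :
  (k < n)%N -> nth (quotients t) k = ((nth t k)^-1 * nth t k.+1)%g.
Proof.
case/tupleP: t => x t ltk.
by rewrite /= theadE (nth_pairmap 1%g) // size_tuple.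
Qed.

Lemma nth_iprism n (i : 'I_n.+1) (t : n.-tuple G) k :
  (k < n.+1)%N ->
  nth (iprism s i t) k =
    if (k < i)%N then nth t k else if k == i then s else (nth t k.-1 ^ s)%g.
Proof.
move=> ltk; have lti := ltn_ord i.
have szt : size (take i t) = i by rewrite size_takel // size_tuple -ltnS.
rewrite /= nth_cat szt; case: (ltngtP k i) => [ki | ik | ->].
- by rewrite nth_take.
- have -> : (k - i)%N = (k.-1 - i).+1 by lia.
  rewrite /= (nth_map 1%g) ?size_drop ?size_tuple; last by lia.
  by rewrite nth_drop; congr (nth _ _ ^ _)%g; lia.
- by rewrite subnn.
Qed.

(** With [p] the partial products, the quotients past position [i] are [(p_(k-1) s)^-1 (p_k s)], a
    conjugate by [s]; the one at [i] is [p_i^-1 (p_i s) = s]. *)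
Lemma quotients_prism n (i : 'I_n.+1) (t : n.-tuple G) :
  quotients (prism s i (products t)) = iprism s i t.
Proof.
apply: eq_from_nth_tuple => k ltk; have lti := ltn_ord i.
have quoE j : (j < n)%N ->
    ((nth (products t) j)^-1 * nth (products t) j.+1)%g = nth t j.
  by move=> ltj; rewrite -nth_quotients ?quotientsK.
rewrite nth_quotients ?nth_prism ?nth_iprism //; last by lia.
case: (ltngtP k i) => [ki | ik | ->].
- by rewrite quoE //; lia.
- case: k ik ltk => // k ik ltk.
  by rewrite -(quoE k) // conjgE invgM !mulgA.
- by rewrite mulKg.
Qed.

(** * The homotopy identity *)

Variable M : gModule G.

Lemma hs_pos_cobdry n (a : homG (stdres G n) M) t :
  hs_pos s (cobdry a) (simplex t) =
    \sum_(i < n.+1) \sum_(j < n.+2)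
      a (simplex (face j (prism s i t))) *~ (-1) ^+ (i + j).
Proof.
rewrite hs_posE; apply: eq_bigr => i _.
rewrite /cobdry [X in X *~ _]/= bdryE hom_sum mulrz_suml; apply: eq_bigr => j _.
by rewrite hom_mulz -mulrzA -exprD addnC.
Qed.

Lemma cobdry_hs_pos n (a : homG (stdres G n.+1) M) t :
  cobdry (hs_pos s a) (simplex t) =
    \sum_(j < n.+2) \sum_(i < n.+1)
      a (simplex (prism s i (face j t))) *~ (-1) ^+ (i + j).
Proof.
rewrite -[LHS]/(hs_pos s a (bdry (simplex t))) bdryE hom_sum.
apply: eq_bigr => j _; rewrite hom_mulz hs_posE mulrz_suml.
by apply: eq_bigr => i _; rewrite -mulrzA -exprD.
Qed.

Lemma signDnn (i : nat) : (-1) ^+ (i + i) = 1 :> int.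
Proof. by rewrite addnn -signr_odd odd_double. Qed.

(** The only prism simplex is the edge from [s_0] to [s_0 s], and its two faces give the two
    terms. *)
Lemma hs_homotopy0 (a : homG (stdres G 0) M) :
  conj_act s a - a = hs_pos s (cobdry a).
Proof.
apply: cochain_ext => t; rewrite homBE conj_act_mulr hs_pos_cobdry.
rewrite big_ord1 big_ord_recr big_ord1 /= mulrN1z mulr1z.
rewrite (face_prism_diag (i := ord0)) // (face_prism_diagS (i := ord0)) //.
by rewrite slice0 slice_size.
Qed.

Lemma hs_homotopyS n (a : homG (stdres G n.+1) M) :
  conj_act s a - a = hs_pos s (cobdry a) + cobdry (hs_pos s a).
Proof.
apply: cochain_ext => t; rewrite homBE homDE conj_act_mulr -slice0.
rewrite -[X in _ - a (simplex X)]slice_size hs_pos_cobdry cobdry_hs_pos.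
(* [prism_sum] takes natural indices, so they are sent back to ordinals by [inord], with the signs
   included. *)
pose F i j : M :=
  a (simplex (face (inord j) (prism s (inord i) t))) *~ (-1) ^+ (i + j).
pose H j i : M :=
  a (simplex (prism s (inord i) (face (inord j) t))) *~ (-1) ^+ (i + j).
rewrite -(prism_sum (m := n.+1) (F := F) (H := H)
                    (fun i => a (simplex (slice i t)))).
- congr (_ + _); apply: eq_bigr => i _; apply: eq_bigr => j _.
    by rewrite /F !inord_val.
  by rewrite /H !inord_val.
- move=> i lei; rewrite /F signDnn mulr1z.
  by rewrite (face_prism_diag (i := inord i)) !inordK //; lia.
- move=> i lei; rewrite /F addnS exprS mulN1r mulrNz signDnn mulr1z.
  by rewrite (face_prism_diagS (i := inord i)) !inordK //; lia.
- move=> i j /andP[ji lei]; rewrite /F /H.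
  (* The drop of the prism index by one produces the opposite sign. *)
  have -> : (i + j)%N = (i.-1 + j).+1 by lia.
  rewrite exprS mulN1r mulrNz; congr (- (a (simplex _) *~ _)).
  by apply: face_prism_lt; rewrite !inordK; lia.
- move=> i j /andP[ij lej]; rewrite /F /H addnS exprS mulN1r mulrNz.
  congr (- (a (simplex _) *~ _)).
  by apply: face_prism_gt; rewrite !inordK; lia.
Qed.

End Prism.

Theorem theorem3p4 (G : groupType) (s : G) (M : gModule G) :
  is_homotopy (conj_cochain_map M s) (id_cochain_map (cochains M)) (hs M s) /\
  (forall (n : nat) (a : icochain M n.+1) (t : n.-tuple G),
     dehomogenize (n := n) (hs M s (Posz n.+1) (homogenize a)) t =
       \sum_(i < n.+1) a (iprism s i t) *~ (-1) ^+ i).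
Proof.
split=> [n x | n a t].
  (* The identity at index [n] lives in degree [n - 1]: index 1 is degree 0, while index 0 and
     [Negz] fall in negative degrees, where both maps are the identity. *)
  case: n x => [[|[|n]]|n] x.
  - by rewrite /= subrr addr0.
  - by rewrite /= addr0; exact: hs_homotopy0.
  - exact: hs_homotopyS.
  - by rewrite /= subrr addr0.
rewrite /dehomogenize -[LHS]/(hs_pos s (homogenize a) (simplex (products t))).
rewrite hs_posE; apply: eq_bigr => i _.
(* The first entry of the prism over [products t] is 1, so the leading action in [homogenize] is
   trivial. *)
by rewrite homogenizeE quotients_prism /thead (tnth_nth 1%g) nth_prism //= gact1.
Qed.
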